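(* Let $S$ and $T$ be inverse semigroups and let $(S,T,X,\langle-,-\rangle,[-,-])$ be an equivalence bimodule. Let $(X,\{\})$ be the generalized heap with $\{xyz\}=\langle x,y\rangle z$, and let $(XX^{-1},X^{-1}X,X,\langle-,-\rangle_1,[-,-]_1)$ be the equivalence bimodule constructed from the generalized heap $(X,\{\})$. Then the two equivalence bimodules $(S,T,X,\langle-,-\rangle,[-,-])$ and $(XX^{-1},X^{-1}X,X,\langle-,-\rangle_1,[-,-]_1)$ are isomorphic.
   Context: Generalized heap: a set $X$ with a (total) ternary operation $(x,y,z)\mapsto\{xyz\}$ satisfying, for all elements: (A1) $\{xxx\}=x$; (A2) $\{\{x_1x_2x_3\}x_4x_5\}=\{x_1\{x_4x_3x_2\}x_5\}=\{x_1x_2\{x_3x_4x_5\}\}$; (A3) $\{xx\{yyz\}\}=\{yy\{xxz\}\}$; (A4) $\{\{zxx\}yy\}=\{\{zyy\}xx\}$. Modules: for an inverse semigroup $S$, a left $S$-module is a set $X$ with a map $S\times X\to X$, $(s,x)\mapsto sx$, such that $(st)x=s(tx)$ and which is unitary: $SX=X$. Right modules are defined dually. An $(S,T)$-bimodule is a left $S$-module and right $T$-module $X$ with $(sx)t=s(xt)$ for all $s\in S$, $t\in T$, $x\in X$. Equivalence bimodule: for inverse semigroups $S,T$, an equivalence bimodule $(S,T,X,\langle-,-\rangle,[-,-])$ is an $(S,T)$-bimodule $X$ with surjective functions $\langle-,-\rangle\colon X\times X\to S$ and $[-,-]\colon X\times X\to T$ such that for all $x,y,z\in X$, $s\in S$,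 $t\in T$: (MC1) $\langle sx,y\rangle=s\langle x,y\rangle$; (MC2) $\langle y,x\rangle=\langle x,y\rangle^{-1}$; (MC3) $\langle x,x\rangle x=x$; (MC4) $[x,yt]=[x,y]t$; (MC5) $[x,y]=[y,x]^{-1}$; (MC6) $x[x,x]=x$; (MC7) $\langle x,y\rangle z=x[y,z]$. For any equivalence bimodule, $\{xyz\}=\langle x,y\rangle z$ makes $X$ a generalized heap. Equivalence bimodule constructed from a generalized heap $(X,\{\})$: put $x\circ y=\{xxy\}$ and $x\bullet y=\{xyy\}$. Then $(X,\circ)$ is a right normal band (idempotent semigroup with $xyz=yxz$) and $(X,\bullet)$ is a left normal band (idempotent semigroup with $xyz=xzy$). Green's relation $\mathcal R$ on $(X,\circ)$ and Green's relation $\mathcal L$ on $(X,\bullet)$ are semilattice congruences; $E=(X,\circ)/\mathcal R$, $F=(X,\bullet)/\mathcal L$, and $p\colon X\to E$, $q\colon X\to F$ are the natural maps. Thus $p(x)=p(y)$ iff $x=\{yyx\}$ and $y=\{xxy\}$; $q(x)=q(y)$ iff $x=\{xyy\}$ and $y=\{yxx\}$. The inverse semigroup $X^{-1}X$: on the set of pairs $(x,y)\in X\times X$ with $p(x)=p(y)$ put $(x,y)\equiv(u,v)$ iff $q(x)=q(u)$, $q(y)=q(v)$ and $y=\{xuv\}$; this is an equivalence relation. Write $x^{-1}y$ for the class of $(x,y)$ and $X^{-1}X$ for the set of classes, with multiplication $x^{-1}y\otimes u^{-1}v=\{\{yuu\}yx\}^{-1}\{yuv\}$; the inverse of $x^{-1}y$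 is $y^{-1}x$. The inverse semigroup $XX^{-1}$: on the set of pairs $(x,y)$ with $q(x)=q(y)$ put $(x,y)\equiv(u,v)$ iff $p(x)=p(u)$, $p(y)=p(v)$ and $x=\{uvy\}$; this is an equivalence relation. Write $xy^{-1}$ for the class of $(x,y)$ and $XX^{-1}$ for the set of classes, with multiplication $xy^{-1}\otimes uv^{-1}=\{xyu\}\{vu\{yyu\}\}^{-1}$; the inverse of $xy^{-1}$ is $yx^{-1}$. The actions are $xy^{-1}\cdot z=\{xyz\}$ and $x\cdot y^{-1}z=\{xyz\}$, and $\langle x,y\rangle_1=\{xyy\}\{yxx\}^{-1}$, $[x,y]_1=\{yyx\}^{-1}\{xxy\}$. These data form an equivalence bimodule. Isomorphism: an isomorphism from $(S,T,X,\langle-,-\rangle,[-,-])$ to $(S',T',X',\langle-,-\rangle',[-,-]')$ consists of semigroup isomorphisms $\alpha\colon S\to S'$, $\beta\colon T\to T'$ and a bijection $\varphi\colon X\to X'$ such that $\varphi(sx)=\alpha(s)\varphi(x)$, $\varphi(xt)=\varphi(x)\beta(t)$, $\alpha(\langle x,y\rangle)=\langle\varphi(x),\varphi(y)\rangle'$ and $\beta([x,y])=[\varphi(x),\varphi(y)]'$ for all $x,y\in X$, $s\in S$, $t\in T$. *)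

(* Defs.v *)
From HB Require Import structures.
From mathcomp Require Import all_boot.
From mathcomp Require Import boolp.

Set Implicit Arguments.
Unset Strict Implicit.
Unset Printing Implicit Defensive.

Local Open Scope group_scope.
Local Open Scope quotient_scope.

Definition inverse_of (S : semigroupType) (s t : S) : Prop :=
  s * t * s = s /\ t * s * t = t.

HB.mixin Record Semigroup_isInverse S of Semigroup S := {
  sinv : S -> S;
  sinvP : forall s : S, inverse_of s (sinv s);
  sinv_uniq : forall s t : S, inverse_of s t -> t = sinv s
}.

#[short(type="invSemigroupType")]
HB.structure Definition InvSemigroup :=
  {S of Semigroup_isInverse S & Semigroup S}.

Section Green.
Variable S : semigroupType.

(* The disjunctions account for the adjoined identity of S^1. *)
Definition in_rideal (x y : S) : Prop := x = y \/ exists s, x = y * s.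
Definition in_lideal (x y : S) : Prop := x = y \/ exists s, x = s * y.

Definition greenR : rel S := fun x y => `[< in_rideal x y /\ in_rideal y x >].
Definition greenL : rel S := fun x y => `[< in_lideal x y /\ in_lideal y x >].

Lemma in_rideal_trans x y z : in_rideal x y -> in_rideal y z -> in_rideal x z.
Proof.
move=> [->|[s ->]] [->|[t ->]]; [by left|by right; exists t|by right; exists s|].
by right; exists (t * s); rewrite mulgA.
Qed.

Lemma in_lideal_trans x y z : in_lideal x y -> in_lideal y z -> in_lideal x z.
Proof.
move=> [->|[s ->]] [->|[t ->]]; [by left|by right; exists t|by right; exists s|].
by right; exists (s * t); rewrite mulgA.
Qed.

Lemma greenR_refl : reflexive greenR.
Proof. by move=> x; apply/asboolP; split; left. Qed.
Lemma greenR_sym : symmetric greenR.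
Proof. by move=> x y; apply: asbool_equiv_eq; split=> -[]. Qed.
Lemma greenR_trans : transitive greenR.
Proof.
move=> y x z /asboolP[xy yx] /asboolP[yz zy]; apply/asboolP.
by split; [exact: in_rideal_trans xy yz|exact: in_rideal_trans zy yx].
Qed.

Lemma greenL_refl : reflexive greenL.
Proof. by move=> x; apply/asboolP; split; left. Qed.
Lemma greenL_sym : symmetric greenL.
Proof. by move=> x y; apply: asbool_equiv_eq; split=> -[]. Qed.
Lemma greenL_trans : transitive greenL.
Proof.
move=> y x z /asboolP[xy yx] /asboolP[yz zy]; apply/asboolP.
by split; [exact: in_lideal_trans xy yz|exact: in_lideal_trans zy yx].
Qed.

Canonical greenR_equiv := EquivRel greenR greenR_refl greenR_sym greenR_trans.
Canonical greenL_equiv := EquivRel greenL greenL_refl greenL_sym greenL_trans.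
End Green.

Record genHeap (X : choiceType) := GenHeap {
  heap_op :> X -> X -> X -> X;
  heap_A1 : forall x, heap_op x x x = x;
  heap_A2 : forall x1 x2 x3 x4 x5,
    heap_op (heap_op x1 x2 x3) x4 x5 = heap_op x1 (heap_op x4 x3 x2) x5 /\
    heap_op x1 (heap_op x4 x3 x2) x5 = heap_op x1 x2 (heap_op x3 x4 x5);
  heap_A3 : forall x y z,
    heap_op x x (heap_op y y z) = heap_op y y (heap_op x x z);
  heap_A4 : forall x y z,
    heap_op (heap_op z x x) y y = heap_op (heap_op z y y) x x
}.

Section Modules.
Variables (S T : invSemigroupType) (X : choiceType).

Definition is_left_module (act : S -> X -> X) : Prop :=
  (forall s t x, act (s * t) x = act s (act t x)) /\
  (forall x, exists s y, act s y = x).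

Definition is_right_module (act : X -> T -> X) : Prop :=
  (forall x s t, act x (s * t) = act (act x s) t) /\
  (forall x, exists y t, act y t = x).

Definition is_bimodule (la : S -> X -> X) (ra : X -> T -> X) : Prop :=
  [/\ is_left_module la, is_right_module ra
    & forall s x t, ra (la s x) t = la s (ra x t)].

Record equivBimodule := EquivBimodule {
  lact : S -> X -> X;
  ract : X -> T -> X;
  lform : X -> X -> S;
  rform : X -> X -> T;
  ebim_bimodule : is_bimodule lact ract;
  lform_surj : forall s, exists x y, lform x y = s;
  rform_surj : forall t, exists x y, rform x y = t;
  ebim_MC1 : forall s x y, lform (lact s x) y = s * lform x y;
  ebim_MC2 : forall x y, lform y x = sinv (lform x y);
  ebim_MC3 : forall x, lact (lform x x) x = x;
  ebim_MC4 : forall x y t, rform x (ract y t) = rform x y * t;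
  ebim_MC5 : forall x y, rform x y = sinv (rform y x);
  ebim_MC6 : forall x, ract x (rform x x) = x;
  ebim_MC7 : forall x y z, lact (lform x y) z = ract x (rform y z)
}.
End Modules.

Definition ebim_isomorphic (S T S' T' : invSemigroupType) (X X' : choiceType)
    (B : equivBimodule S T X) (B' : equivBimodule S' T' X') : Prop :=
  exists (alpha : S -> S') (beta : T -> T') (phi : X -> X'),
    [/\ bijective alpha, {morph alpha : s t / s * t},
        bijective beta, {morph beta : s t / s * t} & bijective phi] /\
    [/\ forall s x, phi (lact B s x) = lact B' (alpha s) (phi x),
        forall x t, phi (ract B x t) = ract B' (phi x) (beta t),
        forall x y, alpha (lform B x y) = lform B' (phi x) (phi y)
      & forall x y, beta (rform B x y) = rform B' (phi x) (phi y)].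

Section InvSemigroupTheory.
Variable S : invSemigroupType.
Implicit Types s t e f : S.

Lemma idem_comm e f : e * e = e -> f * f = f -> e * f = f * e.
Proof.
suff idM (a b : S) : a * a = a -> b * b = b -> (a * b) * (a * b) = a * b.
  move=> ee ff; have i1 := idM _ _ ee ff; have i2 := idM _ _ ff ee.
  have -> : f * e = sinv (e * f).
    apply: sinv_uniq; split.
      by rewrite !mulgA -(mulgA e f f) ff -(mulgA (e * f) e e) ee -mulgA.
    by rewrite !mulgA -(mulgA f e e) ee -(mulgA (f * e) f f) ff -mulgA.
  by apply: sinv_uniq; split; rewrite i1 i1.
move=> aa bb; have [v1 v2] := sinvP (a * b); set x := sinv (a * b) in v1 v2.
have xE : x = b * x * a.
  symmetry; apply: sinv_uniq; split.
    by rewrite !mulgA -(mulgA a b b) bb -(mulgA _ a a) aa -[RHS]v1 !mulgA.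
  rewrite !mulgA -(mulgA _ a a) aa -(mulgA _ b b) bb.
  by rewrite -[in RHS]v2 !mulgA.
have xx : x * x = x.
  by rewrite {1 2}xE !mulgA -!(mulgA b) -[RHS]/x [RHS]xE -{3}v2 !mulgA.
have -> : a * b = sinv x by apply: sinv_uniq; split.
have <- : x = sinv x by apply: sinv_uniq; split; rewrite !xx.
exact: xx.
Qed.

Lemma idem_mulV s : (s * sinv s) * (s * sinv s) = s * sinv s.
Proof. by rewrite mulgA (sinvP s).1. Qed.

Lemma idem_mulVs s : (sinv s * s) * (sinv s * s) = sinv s * s.
Proof. by rewrite mulgA (sinvP s).2. Qed.

Lemma sinvK : involutive (@sinv S).
Proof.
by move=> s; have [v1 v2] := sinvP s; symmetry; apply: sinv_uniq; split.
Qed.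

Lemma sinvM s t : sinv (s * t) = sinv t * sinv s.
Proof.
have C := idem_comm (idem_mulV t) (idem_mulVs s).
symmetry; apply: sinv_uniq; split.
  transitivity (s * ((t * sinv t) * (sinv s * s)) * t); first by rewrite !mulgA.
  rewrite C !mulgA (sinvP s).1 -!mulgA; congr (s * _).
  by rewrite mulgA (sinvP t).1.
transitivity (sinv t * ((sinv s * s) * (t * sinv t)) * sinv s).
  by rewrite !mulgA.
rewrite -C !mulgA (sinvP t).2 -!mulgA; congr (sinv t * _).
by rewrite mulgA (sinvP s).2.
Qed.
End InvSemigroupTheory.

Section HeapOfBimodule.
Variables (S T : invSemigroupType) (X : choiceType) (B : equivBimodule S T X).

Definition bimodule_op (x y z : X) : X := lact B (lform B x y) z.

Let lactM s t x : lact B (s * t) x = lact B s (lact B t x).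
Proof. by have [[-> _] _ _] := ebim_bimodule B. Qed.

Let ractM x s t : ract B x (s * t) = ract B (ract B x s) t.
Proof. by have [_ [-> _] _] := ebim_bimodule B. Qed.

Fact bimodule_op_A1 x : bimodule_op x x x = x.
Proof. exact: ebim_MC3. Qed.

Fact bimodule_op_A2 x1 x2 x3 x4 x5 :
  bimodule_op (bimodule_op x1 x2 x3) x4 x5 =
    bimodule_op x1 (bimodule_op x4 x3 x2) x5 /\
  bimodule_op x1 (bimodule_op x4 x3 x2) x5 =
    bimodule_op x1 x2 (bimodule_op x3 x4 x5).
Proof.
rewrite /bimodule_op (ebim_MC2 B (lact B _ _) x1) !ebim_MC1 sinvM.
by rewrite -!ebim_MC2 !lactM.
Qed.

Fact bimodule_op_A3 x y z :
  bimodule_op x x (bimodule_op y y z) = bimodule_op y y (bimodule_op x x z).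
Proof.
have I w : lform B w w * lform B w w = lform B w w.
  by rewrite -ebim_MC1 ebim_MC3.
by rewrite /bimodule_op -!lactM (idem_comm (I x) (I y)).
Qed.

Fact bimodule_op_A4 x y z :
  bimodule_op (bimodule_op z x x) y y = bimodule_op (bimodule_op z y y) x x.
Proof.
have I w : rform B w w * rform B w w = rform B w w.
  by rewrite -ebim_MC4 ebim_MC6.
by rewrite /bimodule_op !ebim_MC7 -!ractM (idem_comm (I x) (I y)).
Qed.

Definition heap_of_bimodule : genHeap X :=
  GenHeap bimodule_op_A1 bimodule_op_A2 bimodule_op_A3 bimodule_op_A4.
End HeapOfBimodule.

Section HeapTheory.
Variables (X : choiceType) (H : genHeap X).
Implicit Types x y z u v : X.

Lemma heapA x y z u v : H (H x y z) u v = H x y (H z u v).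
Proof. by have [-> ->] := heap_A2 H x y z u v. Qed.

Lemma heapN x y z u v : H x (H u z y) v = H x y (H z u v).
Proof. by have [_ ->] := heap_A2 H x y z u v. Qed.

Lemma heapK x y z : H x x (H x y z) = H x y z.
Proof. by rewrite -heapA heap_A1. Qed.

Lemma heapKm x y z : H x y (H y y z) = H x y z.
Proof. by rewrite -heapN heap_A1. Qed.

Lemma heapC x y z : H x x (H y y z) = H y y (H x x z).
Proof. exact: heap_A3. Qed.

Lemma heapV x y z : H x y (H y x (H x y z)) = H x y z.
Proof. by rewrite -2!heapA heap_A4 heap_A1 heapA heapKm. Qed.

(* prel x y and qrel x y are the elementwise forms of p x = p y and q x = q y. *)
Definition prel x y : Prop := x = H y y x /\ y = H x x y.
Definition qrel x y : Prop := x = H x y y /\ y = H y x x.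

Lemma qrelC x y : qrel x y -> qrel y x.
Proof. by case. Qed.

Lemma prelE x y z : prel x y -> H x x z = H y y z.
Proof. by move=> [xE yE]; rewrite {1}xE heapA heapC -heapA -yE. Qed.

Lemma qrelE x y z : qrel x y -> H z x x = H z y y.
Proof.
move=> [xE yE].
by rewrite {2}xE -heapA heap_A4 heapA -yE.
Qed.

Lemma qrel_form x y : qrel (H x y y) (H y x x).
Proof.
suff f u v : H u v v = H (H u v v) (H v u u) (H v u u) by split; exact: f.
by rewrite !(heapA, heapN) heapV -heapA heap_A4 heap_A1.
Qed.

Lemma formE x y z : H (H x y y) (H y x x) z = H x y z.
Proof. by rewrite !(heapA, heapN) heapV. Qed.

Lemma mul_pairE x y u v z :
  H (H x y u) (H v u (H y y u)) z = H x y (H u v z).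
Proof. by rewrite !(heapA, heapN) heapC heapKm heapK. Qed.

Lemma qrel_mul x y u v : qrel x y -> qrel u v ->
  qrel (H x y u) (H v u (H y y u)).
Proof.
move=> [_ yE] [uE _]; split.
  by rewrite mul_pairE -[H u v _]heapA -uE heapC heap_A1 heapKm.
rewrite !(heapA, heapN) -[H y x _]heapA -yE.
by rewrite [H u u _]heapC heap_A1 !heapK.
Qed.

Lemma trans_inv x y u v : qrel x y -> qrel u v ->
  (forall z, H x y z = H u v z) ->
  [/\ prel x u, prel y v & forall z, H y x z = H v u z].
Proof.
move=> [xE yE] [uE vE] E.
have pxu : prel x u.
  by split; [rewrite xE E heapK|rewrite uE -E heapK].
have Ly z : H y y z = H y x (H x y z) by rewrite -heapA -yE.
have Lv z : H v v z = H v u (H u v z) by rewrite -heapA -vE.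
have Ly' z : H y y (H v v z) = H y y z by rewrite !Ly !E heapKm.
have Lv' z : H v v (H y y z) = H v v z by rewrite !Lv -!E heapKm.
have L z : H y y z = H v v z by rewrite -Ly' heapC Lv'.
split=> // [|z]; first by split; [rewrite -L|rewrite L]; rewrite heap_A1.
rewrite -[LHS]heapKm (prelE _ pxu).
have -> : H u u z = H u v (H v u z) by rewrite -heapA -uE.
by rewrite -E -Ly L heapK.
Qed.

(* For qrel-related pairs, the relation defining XX^{-1} says that the left
   translations H x y and H u v agree. *)
Lemma transP x y u v : qrel x y -> qrel u v ->
  [/\ prel x u, prel y v & x = H u v y] <-> forall z, H x y z = H u v z.
Proof.
move=> qxy quv; split; last first.
  move=> E; have [pxu pyv _] := trans_inv qxy quv E.
  by split=> //; rewrite -E -qxy.1.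
by case=> pxu pyv xE z; rewrite {1}xE heapA (prelE _ pyv) heapKm.
Qed.

Definition op_heap_op x y z := H z y x.

Fact op_heap_A2 x1 x2 x3 x4 x5 :
  op_heap_op (op_heap_op x1 x2 x3) x4 x5 =
    op_heap_op x1 (op_heap_op x4 x3 x2) x5 /\
  op_heap_op x1 (op_heap_op x4 x3 x2) x5 =
    op_heap_op x1 x2 (op_heap_op x3 x4 x5).
Proof. by rewrite /op_heap_op heapN heapA. Qed.

Definition op_heap : genHeap X :=
  @GenHeap X op_heap_op (@heap_A1 X H) op_heap_A2
    (fun x y z => heap_A4 H y x z) (fun x y z => heap_A3 H y x z).
End HeapTheory.

Section Bands.
Variables (X : choiceType) (H : genHeap X).

(* Copies of X; the phantom H0 keys the semigroup structure to the heap. *)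
Definition circ_band (H0 : genHeap X) : Type := X.
Definition bullet_band (H0 : genHeap X) : Type := X.

Definition circ (x y : circ_band H) : circ_band H := H x x y.
Definition bullet (x y : bullet_band H) : bullet_band H := H x y y.

Fact circA : associative circ.
Proof.
move=> x y z; rewrite /circ !(heapA, heapN).
by rewrite [H y y (H x x z)]heap_A3 !heapK.
Qed.

Fact bulletA : associative bullet.
Proof.
move=> x y z; rewrite /bullet !(heapA, heapN).
by rewrite -2![in LHS]heapA heap_A4 !heapA heapKm -heapA heap_A4 heapA.
Qed.

HB.instance Definition _ := Choice.copy (circ_band H) X.
HB.instance Definition _ := Choice.copy (bullet_band H) X.
HB.instance Definition _ := isSemigroup.Build (circ_band H) circA.
HB.instance Definition _ := isSemigroup.Build (bullet_band H) bulletA.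

(* E = (X, circ)/R and F = (X, bullet)/L, with p and q the natural maps. *)
Definition semilatE := {eq_quot @greenR_equiv (circ_band H)}.
Definition semilatF := {eq_quot @greenL_equiv (bullet_band H)}.
HB.instance Definition _ := Choice.on semilatE.
HB.instance Definition _ := Choice.on semilatF.

Definition heap_p (x : X) : semilatE :=
  \pi_{eq_quot @greenR_equiv (circ_band H)} x.
Definition heap_q (x : X) : semilatF :=
  \pi_{eq_quot @greenL_equiv (bullet_band H)} x.

Lemma heap_pP x y : heap_p x = heap_p y <-> prel H x y.
Proof.
have I (a b : circ_band H) : in_rideal a b <-> a = H b b a.
  split=> [[->|[c ->]]|E].
  - by rewrite heap_A1.
  - by rewrite /mul/= /circ heapK.
  - by right; exists a.
split=> [/eqmodP/asboolP[/I xy /I yx]//|[/I xy /I yx]].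
by apply/eqmodP/asboolP; split.
Qed.

Lemma heap_qP x y : heap_q x = heap_q y <-> qrel H x y.
Proof.
have I (a b : bullet_band H) : in_lideal a b <-> a = H a b b.
  split=> [[->|[c ->]]|E].
  - by rewrite heap_A1.
  - by rewrite /mul/= /bullet heapA heap_A1.
  - by right; exists a.
split=> [/eqmodP/asboolP[/I xy /I yx]//|[/I xy /I yx]].
by apply/eqmodP/asboolP; split.
Qed.
End Bands.

Lemma star_inverse_uniq (S : semigroupType) (v : S -> S) :
  involutive v -> (forall s, s * v s * s = s) ->
  (forall s t, (s * v s) * (t * v t) = (t * v t) * (s * v s)) ->
  forall s t, inverse_of s t -> t = v s.
Proof.
move=> vK vS C.
have vS' s : v s * s * v s = v s by rewrite -{2}[s]vK vS.
have idE e : e * e = e -> e = e * v e.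
  move=> ee; set P := v e * e; set Q := e * v e.
  have PQ : P * Q = v e by rewrite /P /Q mulgA -(mulgA (v e)) ee vS'.
  have QP : Q * P = v e by rewrite -PQ /P -{2}[e]vK C vK.
  have PP : P * P = P by rewrite /P mulgA vS'.
  have QQ : Q * Q = Q by rewrite /Q mulgA vS.
  have vv : v e * v e = v e.
    transitivity (Q * P * (P * Q)); first by rewrite QP PQ.
    by rewrite mulgA -(mulgA Q) PP QP -PQ -mulgA QQ.
  have ev : e = v e by rewrite -QP /Q /P mulgA -(mulgA e) vv vS.
  by rewrite /Q -ev ee.
have comm (e f : S) : e * e = e -> f * f = f -> e * f = f * e.
  by move=> ee ff; rewrite (idE e ee) (idE f ff) C.
move=> s t [sts tst].
have i1 : t * s * (t * s) = t * s by rewrite mulgA tst.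
have i2 : s * t * (s * t) = s * t by rewrite mulgA sts.
have i3 : v s * s * (v s * s) = v s * s by rewrite mulgA vS'.
have i4 : s * v s * (s * v s) = s * v s by rewrite mulgA vS.
have h1 : t * s * (v s * s) = t * s by rewrite -(mulgA t) (mulgA s) vS.
have h2 : v s * s * (t * s) = v s * s by rewrite -(mulgA (v s)) (mulgA s) sts.
have e1 : t * s = v s * s by rewrite -h1 comm ?h2.
have h3 : s * v s * (s * t) = s * t by rewrite mulgA vS.
have h4 : s * t * (s * v s) = s * v s by rewrite mulgA sts.
have e2 : s * t = s * v s by rewrite -h3 comm ?h4.
by rewrite -tst -mulgA e2 mulgA e1 vS'.
Qed.

Section XXinv.
Variables (X : choiceType) (H : genHeap X).
Local Notation p := (heap_p H).
Local Notation q := (heap_q H).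

Definition qpair : Type := {xy : X * X | q xy.1 == q xy.2}.
HB.instance Definition _ := Choice.on qpair.

Definition mk_qpair x y (h : q x = q y) : qpair :=
  exist (fun xy : X * X => q xy.1 == q xy.2) (x, y) (introT eqP h).

Definition XXinv_rel : rel qpair := fun a b =>
  let: (x, y) := val a in let: (u, v) := val b in
  [&& p x == p u, p y == p v & x == H u v y].

Lemma qpair_rel (a : qpair) : qrel H (val a).1 (val a).2.
Proof. by apply/heap_qP/eqP; exact: valP a. Qed.

Lemma XXinv_relP (a b : qpair) : reflect
  (forall z, H (val a).1 (val a).2 z = H (val b).1 (val b).2 z) (XXinv_rel a b).
Proof.
have := transP (qpair_rel a) (qpair_rel b).
rewrite /XXinv_rel; case: (val a) (val b) => x y [u v] /= E.
apply: (iffP and3P) => [[/eqP/heap_pP h1 /eqP/heap_pP h2 /eqP h3]|/E[h1 h2 h3]].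
  by apply/E.
by split; apply/eqP => //; apply/heap_pP.
Qed.

Lemma XXinv_rel_refl : reflexive XXinv_rel.
Proof. by move=> a; apply/XXinv_relP. Qed.
Lemma XXinv_rel_sym : symmetric XXinv_rel.
Proof. by move=> a b; apply/XXinv_relP/XXinv_relP. Qed.
Lemma XXinv_rel_trans : transitive XXinv_rel.
Proof.
move=> b a c /XXinv_relP ab /XXinv_relP bc.
by apply/XXinv_relP => z; rewrite ab bc.
Qed.
Canonical XXinv_equiv :=
  EquivRel XXinv_rel XXinv_rel_refl XXinv_rel_sym XXinv_rel_trans.

Definition XXinv : Type := {eq_quot XXinv_equiv}.
HB.instance Definition _ := Choice.on XXinv.

(* The class xy^{-1}. *)
Definition XXinv_class (a : qpair) : XXinv := \pi_{eq_quot XXinv_equiv} a.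

Definition XXinv_repr (A : XXinv) : qpair := @repr _ {eq_quot XXinv_equiv} A.

Lemma XXinv_reprK A : XXinv_class (XXinv_repr A) = A.
Proof. exact: reprK. Qed.

Lemma XXinv_classP a b : XXinv_class a = XXinv_class b <->
  (forall z, H (val a).1 (val a).2 z = H (val b).1 (val b).2 z).
Proof. by split=> [/eqmodP/XXinv_relP|h]; last exact/eqmodP/XXinv_relP. Qed.

Definition XXinv_act (A : XXinv) (z : X) : X :=
  let: (x, y) := val (XXinv_repr A) in H x y z.

Lemma XXinv_actE a z : XXinv_act (XXinv_class a) z = H (val a).1 (val a).2 z.
Proof.
have /XXinv_classP <- := XXinv_reprK (XXinv_class a).
by rewrite /XXinv_act; case: val.
Qed.

Lemma XXinv_act_inj A B : XXinv_act A =1 XXinv_act B -> A = B.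
Proof.
rewrite -[A]XXinv_reprK -[B]XXinv_reprK => h.
by apply/XXinv_classP => z; rewrite -!XXinv_actE.
Qed.

Fact qpair_mul_subproof (a b : qpair) :
  let x := (val a).1 in let y := (val a).2 in
  let u := (val b).1 in let v := (val b).2 in
  q (H x y u) = q (H v u (H y y u)).
Proof. by apply/heap_qP; apply: qrel_mul; exact: qpair_rel. Qed.

Definition qpair_mul (a b : qpair) : qpair :=
  mk_qpair (qpair_mul_subproof a b).

Fact qpair_inv_subproof (a : qpair) : q (val a).2 = q (val a).1.
Proof. by apply/esym/eqP; exact: valP a. Qed.

Definition qpair_inv (a : qpair) : qpair := mk_qpair (qpair_inv_subproof a).

Definition XXinv_mul (A B : XXinv) : XXinv :=
  XXinv_class (qpair_mul (XXinv_repr A) (XXinv_repr B)).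

Definition XXinv_inv (A : XXinv) : XXinv :=
  XXinv_class (qpair_inv (XXinv_repr A)).

Lemma XXinv_act_mul A B z :
  XXinv_act (XXinv_mul A B) z = XXinv_act A (XXinv_act B z).
Proof.
rewrite /XXinv_mul XXinv_actE mul_pairE.
by rewrite -[in RHS](XXinv_reprK A) -[in RHS](XXinv_reprK B) !XXinv_actE.
Qed.

(* The product and the inverse do not depend on the representatives. *)
Lemma XXinv_mulE a b :
  XXinv_mul (XXinv_class a) (XXinv_class b) = XXinv_class (qpair_mul a b).
Proof.
apply: XXinv_act_inj => z.
by rewrite XXinv_act_mul !XXinv_actE mul_pairE.
Qed.

Lemma XXinv_invE a : XXinv_inv (XXinv_class a) = XXinv_class (qpair_inv a).
Proof.
apply/XXinv_classP => z /=.
have /XXinv_classP E := XXinv_reprK (XXinv_class a).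
by have [_ _ ->] := trans_inv (qpair_rel _) (qpair_rel _) E.
Qed.

Fact XXinv_mulA : associative XXinv_mul.
Proof. by move=> A B C; apply: XXinv_act_inj => z; rewrite !XXinv_act_mul. Qed.

HB.instance Definition _ := isSemigroup.Build XXinv XXinv_mulA.

Lemma XXinv_invK : involutive XXinv_inv.
Proof.
move=> A; rewrite -[A]XXinv_reprK !XXinv_invE.
exact/XXinv_classP.
Qed.

Lemma XXinv_mulV_act A z :
  XXinv_act (A * XXinv_inv A) z =
    H (val (XXinv_repr A)).1 (val (XXinv_repr A)).1 z.
Proof.
rewrite XXinv_act_mul -{1 2}[A]XXinv_reprK XXinv_invE !XXinv_actE /=.
by rewrite -heapA -(qpair_rel _).1.
Qed.

Lemma XXinv_mulVK (A : XXinv) : A * XXinv_inv A * A = A.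
Proof.
apply: XXinv_act_inj => z; rewrite XXinv_act_mul XXinv_mulV_act.
by rewrite -[A in XXinv_act A]XXinv_reprK XXinv_actE heapK.
Qed.

Lemma XXinv_mulVC (A B : XXinv) :
  (A * XXinv_inv A) * (B * XXinv_inv B) = (B * XXinv_inv B) * (A * XXinv_inv A).
Proof.
apply: XXinv_act_inj => z.
by rewrite [LHS]XXinv_act_mul [RHS]XXinv_act_mul !XXinv_mulV_act heapC.
Qed.

Fact XXinv_invP (A : XXinv) : inverse_of A (XXinv_inv A).
Proof.
split; first exact: XXinv_mulVK.
by rewrite -{2}[A]XXinv_invK XXinv_mulVK.
Qed.

HB.instance Definition _ := Semigroup_isInverse.Build XXinv XXinv_invP
  (star_inverse_uniq XXinv_invK XXinv_mulVK XXinv_mulVC).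

Fact XXinv_form_subproof x y : q (H x y y) = q (H y x x).
Proof. by apply/heap_qP; exact: qrel_form. Qed.

Definition XXinv_form x y : XXinv :=
  XXinv_class (mk_qpair (XXinv_form_subproof x y)).

Lemma XXinv_formE x y z : XXinv_act (XXinv_form x y) z = H x y z.
Proof. by rewrite XXinv_actE formE. Qed.
End XXinv.

Section XinvX.
Variables (X : choiceType) (H : genHeap X).
Local Notation p := (heap_p H).
Local Notation q := (heap_q H).

Definition ppair : Type := {xy : X * X | p xy.1 == p xy.2}.
HB.instance Definition _ := Choice.on ppair.

Definition mk_ppair x y (h : p x = p y) : ppair :=
  exist (fun xy : X * X => p xy.1 == p xy.2) (x, y) (introT eqP h).

Definition XinvX_rel : rel ppair := fun a b =>
  let: (x, y) := val a in let: (u, v) := val b in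
  [&& q x == q u, q y == q v & y == H x u v].

Lemma ppair_rel (a : ppair) : prel H (val a).1 (val a).2.
Proof. by apply/heap_pP/eqP; exact: valP a. Qed.

Lemma ppair_relC (a : ppair) : qrel (op_heap H) (val a).2 (val a).1.
Proof. by have [] := ppair_rel a. Qed.

Lemma XinvX_relP (a b : ppair) : reflect
  (forall z, H z (val a).1 (val a).2 = H z (val b).1 (val b).2) (XinvX_rel a b).
Proof.
have := transP (H := op_heap H) (ppair_relC a) (ppair_relC b).
rewrite /XinvX_rel; case: (val a) (val b) => x y [u v] /= E.
apply: (iffP and3P) => [[/eqP/heap_qP h1 /eqP/heap_qP h2 /eqP h3]|/E[h1 h2 h3]].
  by apply/E.
by split; apply/eqP => //; apply/heap_qP.
Qed.

Lemma XinvX_rel_refl : reflexive XinvX_rel.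
Proof. by move=> a; apply/XinvX_relP. Qed.
Lemma XinvX_rel_sym : symmetric XinvX_rel.
Proof. by move=> a b; apply/XinvX_relP/XinvX_relP. Qed.
Lemma XinvX_rel_trans : transitive XinvX_rel.
Proof.
move=> b a c /XinvX_relP ab /XinvX_relP bc.
by apply/XinvX_relP => z; rewrite ab bc.
Qed.
Canonical XinvX_equiv :=
  EquivRel XinvX_rel XinvX_rel_refl XinvX_rel_sym XinvX_rel_trans.

Definition XinvX : Type := {eq_quot XinvX_equiv}.
HB.instance Definition _ := Choice.on XinvX.

(* The class x^{-1}y. *)
Definition XinvX_class (a : ppair) : XinvX := \pi_{eq_quot XinvX_equiv} a.

Definition XinvX_repr (A : XinvX) : ppair := @repr _ {eq_quot XinvX_equiv} A.

Lemma XinvX_reprK A : XinvX_class (XinvX_repr A) = A.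
Proof. exact: reprK. Qed.

Lemma XinvX_classP a b : XinvX_class a = XinvX_class b <->
  (forall z, H z (val a).1 (val a).2 = H z (val b).1 (val b).2).
Proof. by split=> [/eqmodP/XinvX_relP|h]; last exact/eqmodP/XinvX_relP. Qed.

Definition XinvX_act (z : X) (A : XinvX) : X :=
  let: (x, y) := val (XinvX_repr A) in H z x y.

Lemma XinvX_actE z a : XinvX_act z (XinvX_class a) = H z (val a).1 (val a).2.
Proof.
have /XinvX_classP <- := XinvX_reprK (XinvX_class a).
by rewrite /XinvX_act; case: val.
Qed.

Lemma XinvX_act_inj A B : XinvX_act^~ A =1 XinvX_act^~ B -> A = B.
Proof.
rewrite -[A]XinvX_reprK -[B]XinvX_reprK => h.
by apply/XinvX_classP => z; rewrite -!XinvX_actE.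
Qed.

Fact ppair_mul_subproof (a b : ppair) :
  let x := (val a).1 in let y := (val a).2 in
  let u := (val b).1 in let v := (val b).2 in
  p (H (H y u u) y x) = p (H y u v).
Proof.
apply/heap_pP/(@qrelC _ (op_heap H)); apply: (@qrel_mul _ (op_heap H)).
  exact: ppair_relC b.
exact: ppair_relC a.
Qed.

Definition ppair_mul (a b : ppair) : ppair :=
  mk_ppair (ppair_mul_subproof a b).

Fact ppair_inv_subproof (a : ppair) : p (val a).2 = p (val a).1.
Proof. by apply/esym/eqP; exact: valP a. Qed.

Definition ppair_inv (a : ppair) : ppair := mk_ppair (ppair_inv_subproof a).

Definition XinvX_mul (A B : XinvX) : XinvX :=
  XinvX_class (ppair_mul (XinvX_repr A) (XinvX_repr B)).

Definition XinvX_inv (A : XinvX) : XinvX :=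
  XinvX_class (ppair_inv (XinvX_repr A)).

Lemma ppair_mulE x y u v z :
  H z (H (H y u u) y x) (H y u v) = H (H z x y) u v.
Proof. exact: (mul_pairE (op_heap H)). Qed.

Lemma XinvX_act_mul z A B :
  XinvX_act z (XinvX_mul A B) = XinvX_act (XinvX_act z A) B.
Proof.
rewrite /XinvX_mul XinvX_actE ppair_mulE.
by rewrite -[in RHS](XinvX_reprK A) -[in RHS](XinvX_reprK B) !XinvX_actE.
Qed.

(* The product and the inverse do not depend on the representatives. *)
Lemma XinvX_mulE a b :
  XinvX_mul (XinvX_class a) (XinvX_class b) = XinvX_class (ppair_mul a b).
Proof.
apply: XinvX_act_inj => z.
by rewrite XinvX_act_mul !XinvX_actE ppair_mulE.
Qed.

Lemma XinvX_invE a : XinvX_inv (XinvX_class a) = XinvX_class (ppair_inv a).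
Proof.
apply/XinvX_classP => z /=.
have /XinvX_classP E := XinvX_reprK (XinvX_class a).
have [_ _ E2] := trans_inv (H := op_heap H)
  (ppair_relC _) (ppair_relC _) E; exact: E2.
Qed.

Fact XinvX_mulA : associative XinvX_mul.
Proof. by move=> A B C; apply: XinvX_act_inj => z; rewrite !XinvX_act_mul. Qed.

HB.instance Definition _ := isSemigroup.Build XinvX XinvX_mulA.

Lemma XinvX_invK : involutive XinvX_inv.
Proof.
move=> A; rewrite -[A]XinvX_reprK !XinvX_invE.
exact/XinvX_classP.
Qed.

Lemma XinvX_mulVs_act z A :
  XinvX_act z (A * XinvX_inv A) =
    H z (val (XinvX_repr A)).1 (val (XinvX_repr A)).1.
Proof.
rewrite XinvX_act_mul -{1 2}[A]XinvX_reprK XinvX_invE !XinvX_actE /=.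
by rewrite heapA -(ppair_rel _).1.
Qed.

Lemma XinvX_mulVK (A : XinvX) : A * XinvX_inv A * A = A.
Proof.
apply: XinvX_act_inj => z /=; rewrite XinvX_act_mul XinvX_mulVs_act.
by rewrite -[A in XinvX_act _ A]XinvX_reprK XinvX_actE heapA heapKm -XinvX_actE XinvX_reprK.
Qed.

Lemma XinvX_mulVC (A B : XinvX) :
  (A * XinvX_inv A) * (B * XinvX_inv B) = (B * XinvX_inv B) * (A * XinvX_inv A).
Proof.
apply: XinvX_act_inj => z /=.
rewrite [LHS]XinvX_act_mul [RHS]XinvX_act_mul !XinvX_mulVs_act.
exact: heap_A4.
Qed.

Fact XinvX_invP (A : XinvX) : inverse_of A (XinvX_inv A).
Proof.
split; first exact: XinvX_mulVK.
by rewrite -{2}[A]XinvX_invK XinvX_mulVK.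
Qed.

HB.instance Definition _ := Semigroup_isInverse.Build XinvX XinvX_invP
  (star_inverse_uniq XinvX_invK XinvX_mulVK XinvX_mulVC).

Fact XinvX_form_subproof x y : p (H y y x) = p (H x x y).
Proof. by apply/heap_pP; exact: (qrel_form (op_heap H)). Qed.

Definition XinvX_form x y : XinvX :=
  XinvX_class (mk_ppair (XinvX_form_subproof x y)).

Lemma XinvX_formE x y z : XinvX_act z (XinvX_form x y) = H z x y.
Proof. by rewrite XinvX_actE; exact: (formE (op_heap H)). Qed.
End XinvX.

Section BimoduleOfHeap.
Variables (X : choiceType) (H : genHeap X).

Fact heap_bimodule_axiom : is_bimodule (@XXinv_act X H) (@XinvX_act X H).
Proof.
split.
- split=> [A B x|x]; first exact: XXinv_act_mul.
  by exists (XXinv_form H x x), x; rewrite XXinv_formE heap_A1.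
- split=> [x A B|x]; first exact: XinvX_act_mul.
  by exists x, (XinvX_form H x x); rewrite XinvX_formE heap_A1.
- move=> A x B; rewrite -[A]XXinv_reprK -[B]XinvX_reprK.
  by rewrite !XXinv_actE !XinvX_actE heapA.
Qed.

Fact XXinv_form_surj A : exists x y, XXinv_form H x y = A.
Proof.
exists (val (XXinv_repr A)).1, (val (XXinv_repr A)).2.
apply: XXinv_act_inj => z.
by rewrite XXinv_formE -[A in RHS]XXinv_reprK XXinv_actE.
Qed.

Fact XinvX_form_surj A : exists x y, XinvX_form H x y = A.
Proof.
exists (val (XinvX_repr A)).1, (val (XinvX_repr A)).2.
apply: XinvX_act_inj => z /=.
by rewrite XinvX_formE -[A in RHS]XinvX_reprK XinvX_actE.
Qed.

Fact heap_MC1 A x y :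
  XXinv_form H (XXinv_act A x) y = A * XXinv_form H x y.
Proof.
apply: XXinv_act_inj => z; rewrite [RHS]XXinv_act_mul !XXinv_formE.
by rewrite -[A]XXinv_reprK !XXinv_actE heapA.
Qed.

Fact heap_MC2 x y : XXinv_form H y x = sinv (XXinv_form H x y).
Proof. by rewrite [RHS]XXinv_invE; apply/XXinv_classP. Qed.

Fact heap_MC3 x : XXinv_act (XXinv_form H x x) x = x.
Proof. by rewrite XXinv_formE heap_A1. Qed.

Fact heap_MC4 x y B :
  XinvX_form H x (XinvX_act y B) = XinvX_form H x y * B.
Proof.
apply: XinvX_act_inj => z /=; rewrite [RHS]XinvX_act_mul !XinvX_formE.
by rewrite -[B]XinvX_reprK !XinvX_actE heapA.
Qed.

Fact heap_MC5 x y : XinvX_form H x y = sinv (XinvX_form H y x).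
Proof. by rewrite [RHS]XinvX_invE; apply/XinvX_classP. Qed.

Fact heap_MC6 x : XinvX_act x (XinvX_form H x x) = x.
Proof. by rewrite XinvX_formE heap_A1. Qed.

Fact heap_MC7 x y z :
  XXinv_act (XXinv_form H x y) z = XinvX_act x (XinvX_form H y z).
Proof. by rewrite XXinv_formE XinvX_formE. Qed.

Definition bimodule_of_heap : equivBimodule (XXinv H) (XinvX H) X :=
  EquivBimodule heap_bimodule_axiom XXinv_form_surj XinvX_form_surj
    heap_MC1 heap_MC2 heap_MC3 heap_MC4 heap_MC5 heap_MC6 heap_MC7.
End BimoduleOfHeap.

(* Main.v *)
Require Import Defs.
From mathcomp Require Import all_boot.
From mathcomp Require Import boolp.

Set Implicit Arguments.
Unset Strict Implicit.
Unset Printing Implicit Defensive.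

Local Open Scope group_scope.

(** An element of S is determined by the left translation of X that it induces,
    because the form is onto S and an inverse semigroup acts faithfully on
    itself ([mul_faithful], [lact_inj]); an element of XX^{-1} is likewise
    determined by its translation.  The two families of translations coincide: by surjectivity
    of the forms, each consists exactly of the maps z |-> {xyz}, which is how
    both <x,y> and <x,y>_1 act.  Matching elements that induce the same
    translation is therefore a bijection alpha from S to XX^{-1}
    ([same_translations]), and T is matched with X^{-1}X by right translations
    in the same way.  With the identity on X these maps form the isomorphism:
    each required equation between elements of a semigroup holds because both
    sides induce the same translation, and those on X say just that matched
    elements act alike. *)

Lemma mul_faithful (S : invSemigroupType) (s t : S) :
  (forall r, s * r = t * r) -> s = t.
Proof.
move=> st; set e := sinv s * s; set f := sinv t * t.
have sE : s * e = s by rewrite mulgA (sinvP s).1.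
have tF : t * f = t by rewrite mulgA (sinvP t).1.
(* Both sides equal s e f, since the idempotents e and f commute. *)
have -> : s = s * (f * e) by rewrite mulgA st tF -st.
by rewrite (idem_comm (idem_mulVs t) (idem_mulVs s)) mulgA sE st.
Qed.

(** Inversion exchanges left and right multiplications. *)
Lemma mul_faithful_r (S : invSemigroupType) (s t : S) :
  (forall r, r * s = r * t) -> s = t.
Proof.
move=> st; apply: (can_inj (@sinvK S)); apply: mul_faithful => r.
by rewrite -[r]sinvK -!sinvM st.
Qed.

Section Faithful.
Variables (S T : invSemigroupType) (X : choiceType) (B : equivBimodule S T X).

(** Feeding the equation s x = t x into the form gives s <x,y> = t <x,y>, and
    <x,y> runs over all of S. *)
Lemma lact_inj (s t : S) : lact B s =1 lact B t -> s = t.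
Proof.
move=> st; apply: mul_faithful => r; have [x [y <-]] := lform_surj B r.
by rewrite -!ebim_MC1 st.
Qed.

Lemma ract_inj (s t : T) : (ract B)^~ s =1 (ract B)^~ t -> s = t.
Proof.
move=> st; apply: mul_faithful_r => r; have [x [y <-]] := rform_surj B r.
by rewrite -!ebim_MC4 st.
Qed.
End Faithful.

(** Each index goes to the only index of the other family that induces the same
    self-map of X.  The families are curried with the index first and need no
    algebraic structure, so that the statement serves left and right
    translations alike. *)
Lemma same_translations (I J X : Type) (a : I -> X -> X) (b : J -> X -> X) :
  (forall i i', a i =1 a i' -> i = i') ->
  (forall j j', b j =1 b j' -> j = j') ->
  (forall i, exists j, b j =1 a i) -> (forall j, exists i, a i =1 b j) ->
  exists2 f : I -> J, bijective f & forall i, b (f i) =1 a i.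
Proof.
move=> a_inj b_inj /choice[f fE] /choice[g gE]; exists f => //.
exists g => [i|j]; first by apply: a_inj => x; rewrite gE fE.
by apply: b_inj => x; rewrite fE gE.
Qed.

Theorem proposition4p2 (S T : invSemigroupType) (X : choiceType)
    (B : equivBimodule S T X) :
  ebim_isomorphic B (bimodule_of_heap (heap_of_bimodule B)).
Proof.
set H := heap_of_bimodule B.
have [[lactM _] [ractM _] _] := ebim_bimodule B.
have ltransl x y : XXinv_act (XXinv_form H x y) =1 lact B (lform B x y).
  by move=> z; rewrite XXinv_formE.
have rtransl x y :
    (@XinvX_act X H)^~ (XinvX_form H x y) =1 (ract B)^~ (rform B x y).
  by move=> z; rewrite XinvX_formE /= /bimodule_op ebim_MC7.
have [alpha alpha_bij alphaE] :
    exists2 f : S -> XXinv H,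
      bijective f & forall s, XXinv_act (f s) =1 lact B s.
  apply: same_translations => [||s|A].
  - exact: lact_inj.
  - exact: XXinv_act_inj.
  - by have [x [y <-]] := lform_surj B s; exists (XXinv_form H x y).
  - have [x [y <-]] := XXinv_form_surj A.
    by exists (lform B x y) => z; rewrite ltransl.
have [beta beta_bij betaE] :
    exists2 f : T -> XinvX H,
      bijective f & forall t, (@XinvX_act X H)^~ (f t) =1 (ract B)^~ t.
  apply: (same_translations (a := fun t => (ract B)^~ t)
                            (b := fun A => (@XinvX_act X H)^~ A)) => [||t|A].
  - exact: ract_inj.
  - exact: XinvX_act_inj.
  - by have [x [y <-]] := rform_surj B t; exists (XinvX_form H x y).
  - have [x [y <-]] := XinvX_form_surj A.
    by exists (rform B x y) => z; rewrite -rtransl.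
exists alpha, beta, id; split; split=> //.
- move=> s t; apply: XXinv_act_inj => z.
  by rewrite [RHS]XXinv_act_mul !alphaE lactM.
- move=> s t; apply: XinvX_act_inj => z /=.
  by rewrite [RHS]XinvX_act_mul !betaE ractM.
- by exists id.
- by move=> s x; rewrite /= alphaE.
- by move=> x t; rewrite /= betaE.
- by move=> x y; apply: XXinv_act_inj => z; rewrite alphaE /= ltransl.
- by move=> x y; apply: XinvX_act_inj => z; rewrite betaE /= rtransl.
Qed.
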